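(* Let $\mathbb F\in\{\mathbb R,\mathbb C\}$ and let $P(\lambda)=\lambda(J_1+R_1)+(J_2+R_2)\in\mathbb F^{n,n}[\lambda]$, where $J_i^*=-J_i$ and $R_i^*=R_i\ge 0$ for $i=1,2$. If $(x_1,\dots,x_{k+1})$ is a singular chain of $P(\lambda)$ associated with a left or right minimal index $\eta=k$, then $x_1,\dots,x_{k+1}\in\ker R_1\cap\ker R_2$, and $(x_1,\dots,x_{k+1})$ is also a singular chain of $\lambda J_1+J_2$ associated with a left, respectively right, minimal index $\eta=k$.
   Context: $M^*$ denotes the conjugate transpose, $M\ge 0$ means Hermitian positive semidefinite. For a pencil $\lambda E-A$ and $k\ge 0$, a tuple of vectors $(x_1,\dots,x_{k+1})$ is called a singular chain associated with a right minimal index $k$ if $Ex_1=0$, $Ex_{j+1}=Ax_j$ for $j=1,\dots,k$, and $Ax_{k+1}=0$. It is called a singular chain associated with a left minimal index $k$ if $x_1^*E=0$, $x_{j+1}^*E=x_j^*A$ for $j=1,\dots,k$, and $x_{k+1}^*A=0$. (The phrase ''associated with a minimal index $k$'' refers only to these chain relations of length $k+1$.) For $P(\lambda)$ one takes $E=J_1+R_1$, $A=-(J_2+R_2)$; for $\lambda J_1+J_2$ one takes $E=J_1$, $A=-J_2$. *)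

(* Defs.v *)
From mathcomp Require Import all_boot all_order all_algebra.
From mathcomp Require Import reals complex.

Set Implicit Arguments.
Unset Strict Implicit.
Unset Printing Implicit Defensive.

Import Order.TTheory GRing.Theory Num.Theory.
Local Open Scope ring_scope.
Local Open Scope sesquilinear_scope.

(* The pairs (F, theta) with F the field of real or of complex numbers and
   theta its conjugation, so that [M ^t theta] is the conjugate transpose
   (the plain transpose over the reals). *)
Inductive real_or_complex (R : realType) :
    forall F : numFieldType, (F -> F) -> Prop :=
| RealScalars : @real_or_complex R R idfun
| ComplexScalars : @real_or_complex R R[i] Num.conj.
Arguments real_or_complex R F theta : clear implicits.

(* In a [numFieldType], [0 <= z] entails that z is real. *)
Definition psdmx (F : numFieldType) (theta : F -> F) (n : nat) (M : 'M[F]_n) :=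
  M ^t theta = M /\
  forall v : 'cV[F]_n, 0 <= (v ^t theta *m M *m v) ord0 ord0.

(* Chains of the pencil [lambda E - A]. The vector written x_(i+1) on paper is
   [tnth x i]: for j : 'I_k, [widen_ord (leqnSn k) j] has value j and
   [lift ord0 j] has value j + 1. The vectors may be zero or dependent. *)
Definition right_singular_chain (F : numFieldType) (n k : nat)
    (E A : 'M[F]_n) (x : k.+1.-tuple 'cV[F]_n) :=
  [/\ E *m tnth x ord0 = 0,
      forall j : 'I_k,
        E *m tnth x (lift ord0 j) = A *m tnth x (widen_ord (leqnSn k) j)
    & A *m tnth x ord_max = 0].

Definition left_singular_chain (F : numFieldType) (theta : F -> F) (n k : nat)
    (E A : 'M[F]_n) (x : k.+1.-tuple 'cV[F]_n) :=
  [/\ (tnth x ord0) ^t theta *m E = 0,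
      forall j : 'I_k,
        (tnth x (lift ord0 j)) ^t theta *m E =
        (tnth x (widen_ord (leqnSn k) j)) ^t theta *m A
    & (tnth x ord_max) ^t theta *m A = 0].

(* Main.v *)
Require Import Defs.
From mathcomp Require Import all_boot all_order all_algebra.
From mathcomp Require Import reals complex.
From mathcomp Require Import ring.

(** Pair the chain vectors with one another through E = J1 + R1 and
    B = J2 + R2 (so that A = - B), setting
    a i j = x_i^* E x_j and b i j = x_i^* B x_j.  The chain relations read
    a i 0 = 0, a i (j + 1) = - b i j, and b i max = 0.

    Two facts about a matrix J + R with J skew-Hermitian and R positive
    semidefinite drive the argument.  If v^* (J + R) v = 0, then the Hermitian
    part v^* R v vanishes, hence R v = 0 ([skew_psd_kernel]).  Once R v = 0,
    the form u^* (J + R) v agrees with the skew-Hermitian u^* J v, so it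
    vanishes iff v^* (J + R) u does ([skew_form_sym]).

    One then propagates along the chain the assertion that column i of a is
    zero ([chain_form_eq0]).  It is true for i = 0 because E x_0 = 0.  If it
    holds at i, then a i i = 0 gives R1 x_i = 0, so row i of a is zero as well;
    the chain relations turn this into the vanishing of row i of b, in
    particular b i i = 0, so R2 x_i = 0; hence column i of b is zero too, and
    this is column i + 1 of a up to sign.  So all x_i are killed by R1 and R2,
    and these matrices may be dropped from the chain relations.

    A left chain of a pencil is a right chain of the conjugate transpose pencil
    ([left_chain_adjoint]), which has the same R1 and R2 and opposite J1 and
    J2; the statement for left chains follows. *)

Set Implicit Arguments.
Unset Strict Implicit.
Unset Printing Implicit Defensive.

Import Order.TTheory GRing.Theory Num.Theory.
Local Open Scope ring_scope.
Local Open Scope sesquilinear_scope.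

(** The common properties of the identity of the reals and of complex
    conjugation; through them both cases are treated at once. *)
Definition positive_involution (F : numFieldType) (theta : F -> F) :=
  involutive theta /\ forall z, 0 <= theta z * z.

(** * Conjugate transposes *)

Lemma adjointM (F : numFieldType) (theta : {rmorphism F -> F}) m n p
    (A : 'M[F]_(m, n)) (B : 'M[F]_(n, p)) :
  (A *m B) ^t theta = B ^t theta *m A ^t theta.
Proof. by rewrite trmx_mul map_mxM. Qed.

Lemma adjointK (F : numFieldType) (theta : {rmorphism F -> F}) m n
    (A : 'M[F]_(m, n)) :
  involutive theta -> (A ^t theta) ^t theta = A.
Proof. by move=> thetaK; apply/matrixP => i j; rewrite !mxE thetaK. Qed.

Lemma adjointD (F : numFieldType) (theta : {rmorphism F -> F}) m n
    (A B : 'M[F]_(m, n)) :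
  (A + B) ^t theta = A ^t theta + B ^t theta.
Proof. by rewrite linearD map_mxD. Qed.

Lemma adjointN (F : numFieldType) (theta : {rmorphism F -> F}) m n
    (A : 'M[F]_(m, n)) :
  (- A) ^t theta = - (A ^t theta).
Proof. by rewrite linearN map_mxN. Qed.

Lemma adjoint0 (F : numFieldType) (theta : {rmorphism F -> F}) m n :
  (0 : 'M[F]_(m, n)) ^t theta = 0.
Proof. by rewrite trmx0 map_mx0. Qed.

Lemma adjointZ (F : numFieldType) (theta : {rmorphism F -> F}) m n a
    (A : 'M[F]_(m, n)) :
  (a *: A) ^t theta = theta a *: A ^t theta.
Proof. by rewrite linearZ map_mxZ. Qed.

Lemma hermitian_entry (F : numFieldType) (theta : {rmorphism F -> F})
    (A : 'M[F]_1) :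
  A ^t theta = A -> theta (A ord0 ord0) = A ord0 ord0.
Proof. by move=> hA; rewrite -[in RHS]hA !mxE. Qed.

Lemma normsq_ge0 (F : numFieldType) (theta : {rmorphism F -> F}) n
    (w : 'cV[F]_n) :
  positive_involution theta -> 0 <= (w ^t theta *m w) ord0 ord0.
Proof. by case=> _ hpos; rewrite mxE sumr_ge0 // => i _; rewrite !mxE. Qed.

Lemma normsq_eq0 (F : numFieldType) (theta : {rmorphism F -> F}) n
    (w : 'cV[F]_n) :
  positive_involution theta -> (w ^t theta *m w) ord0 ord0 = 0 -> w = 0.
Proof.
case=> _ hpos; rewrite mxE => w0.
apply/matrixP => i j; rewrite ord1 [RHS]mxE.
have term_ge0 l : true -> 0 <= (w ^t theta) ord0 l * w l ord0.
  by rewrite !mxE.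
have /eqP := psumr_eq0P term_ge0 w0 (i := i) isT.
by rewrite !mxE mulf_eq0 fmorph_eq0 orbb => /eqP.
Qed.

(** * Skew-Hermitian plus positive semidefinite matrices *)

(** With w = M v, s = w^* w and c = w^* M w, positivity of M at the vector
    (1 + c) v - s w says that 0 <= - s^2 (2 + c), which forces s = 0. *)
Lemma psdmx_kernel (F : numFieldType) (theta : {rmorphism F -> F}) n
    (M : 'M[F]_n) (v : 'cV[F]_n) :
  positive_involution theta -> psdmx theta M ->
  v ^t theta *m M *m v = 0 -> M *m v = 0.
Proof.
move=> htheta [hM Mge0] vMv; have [thetaK _] := htheta.
have [w Mv] : exists w, M *m v = w by exists (M *m v).
rewrite Mv; apply: normsq_eq0 (htheta) _.
have [S wS] : exists S, w ^t theta *m w = S by exists (w ^t theta *m w).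
have [C wC] : exists C, w ^t theta *m M *m w = C.
  by exists (w ^t theta *m M *m w).
rewrite wS; set s := S _ _; pose c := C ord0 ord0.
have s_ge0 : 0 <= s by rewrite /s -wS; apply: normsq_ge0.
have c_ge0 : 0 <= c by rewrite /c -wC; apply: Mge0.
have thetas : theta s = s.
  by rewrite /s hermitian_entry // -wS adjointM adjointK.
have thetac : theta c = c.
  by rewrite /c hermitian_entry // -wC !adjointM adjointK // hM mulmxA.
have vMw : v ^t theta *m M *m w = S by rewrite -wS -Mv adjointM hM.
have wMv : w ^t theta *m M *m v = S by rewrite -wS -mulmxA Mv.
have := Mge0 ((1 + c) *: v - s *: w).
rewrite adjointD adjointN !adjointZ rmorphD rmorph1 thetas thetac.
rewrite !(mulmxDl, mulmxDr, mulNmx, mulmxN) -!(scalemxAl, scalemxAr).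
rewrite vMw wMv vMv wC !mxE -/s -/c.
set q := (X in 0 <= X).
have -> : q = - (s * s * (2 + c)) by rewrite /q; ring.
rewrite oppr_ge0 => q_le0.
have c2_gt0 : 0 < 2 + c by rewrite ltr_wpDr.
have : s * s * (2 + c) == 0.
  by rewrite eq_le q_le0 !mulr_ge0 // ltW.
by rewrite !mulf_eq0 (gt_eqF c2_gt0) orbF orbb => /eqP.
Qed.

(** Adding to v^* (J + M) v = 0 its conjugate removes J and leaves
    2 v^* M v = 0. *)
Lemma skew_psd_kernel (F : numFieldType) (theta : {rmorphism F -> F}) n
    (J M : 'M[F]_n) (v : 'cV[F]_n) :
  positive_involution theta -> J ^t theta = - J -> psdmx theta M ->
  v ^t theta *m (J + M) *m v = 0 -> M *m v = 0.
Proof.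
move=> htheta hJ hM q0; apply: psdmx_kernel (hM) _ => //.
have [[thetaK _] [hMt _]] := (htheta, hM).
have := congr1 (fun N : 'M_1 => N ^t theta + N) q0.
rewrite adjoint0 !adjointM adjointD adjointK // hJ hMt mulmxA q0.
rewrite -[X in _ + X]q0 -mulmxDl -mulmxDr addr0.
have -> : - J + M + (J + M) = 2 *: M.
  by rewrite addrACA addNr add0r scaler_nat mulr2n.
rewrite -scalemxAr -scalemxAl => /eqP.
by rewrite scaler_eq0 pnatr_eq0 /= => /eqP.
Qed.

(** If M v = 0 then v^* M = 0 as well, so M drops out of both forms and what
    remains is skew-Hermitian. *)
Lemma skew_form_sym (F : numFieldType) (theta : {rmorphism F -> F}) n
    (J M : 'M[F]_n) (u v : 'cV[F]_n) :
  positive_involution theta -> J ^t theta = - J -> M ^t theta = M ->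
  M *m v = 0 ->
  u ^t theta *m (J + M) *m v = 0 <-> v ^t theta *m (J + M) *m u = 0.
Proof.
move=> [thetaK _] hJ hM Mv.
have vM : v ^t theta *m M = 0 by rewrite -{1}hM -adjointM Mv adjoint0.
rewrite mulmxDr [in X in _ <-> X]mulmxDr vM addr0 mulmxDl -[X in _ + X]mulmxA.
rewrite Mv mulmx0 addr0.
have adjJ (a b : 'cV[F]_n) :
    (a ^t theta *m J *m b) ^t theta = - (b ^t theta *m J *m a).
  by rewrite !adjointM adjointK // hJ mulNmx mulmxN mulmxA.
split=> [/(congr1 (fun N : 'M_1 => N ^t theta))
        |/(congr1 (fun N : 'M_1 => N ^t theta))];
  by rewrite adjJ adjoint0 => /eqP; rewrite oppr_eq0 => /eqP.
Qed.

(** * Singular chains *)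

Lemma lift_max_widen k (j : 'I_k) : lift ord_max j = widen_ord (leqnSn k) j.
Proof. by apply: val_inj; exact: lift_max. Qed.

(** The step from a vanishing column i of the form x_l^* (J1 + R1) x_i;
    the conclusion is used to pass to column i + 1. *)
Lemma chain_form_step (F : numFieldType) (theta : {rmorphism F -> F}) n
    (J1 J2 R1 R2 : 'M[F]_n) k (x : k.+1.-tuple 'cV[F]_n) (i : 'I_k.+1) :
  positive_involution theta ->
  J1 ^t theta = - J1 -> J2 ^t theta = - J2 ->
  psdmx theta R1 -> psdmx theta R2 ->
  right_singular_chain (J1 + R1) (- (J2 + R2)) x ->
  (forall l, (tnth x l) ^t theta *m (J1 + R1) *m tnth x i = 0) ->
  [/\ R1 *m tnth x i = 0, R2 *m tnth x i = 0
    & forall l, (tnth x l) ^t theta *m (J2 + R2) *m tnth x i = 0].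
Proof.
move=> htheta hJ1 hJ2 hR1 hR2 [_ xS xmax] coli.
have [[hR1t _] [hR2t _]] := (hR1, hR2).
have R1i : R1 *m tnth x i = 0 by apply: (skew_psd_kernel htheta hJ1 hR1).
have rowE l : (tnth x i) ^t theta *m (J1 + R1) *m tnth x l = 0.
  exact/(skew_form_sym _ htheta hJ1 hR1t R1i).
have rowB l : (tnth x i) ^t theta *m (J2 + R2) *m tnth x l = 0.
  apply: oppr_inj; rewrite oppr0 -mulmxA -mulmxN -mulNmx.
  case: (unliftP ord_max l) => [j|] ->; last by rewrite xmax mulmx0.
  by rewrite lift_max_widen -xS mulmxA.
have R2i : R2 *m tnth x i = 0 by apply: (skew_psd_kernel htheta hJ2 hR2).
by split=> // l; apply/(skew_form_sym _ htheta hJ2 hR2t R2i).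
Qed.

Lemma chain_form_eq0 (F : numFieldType) (theta : {rmorphism F -> F}) n
    (J1 J2 R1 R2 : 'M[F]_n) k (x : k.+1.-tuple 'cV[F]_n) :
  positive_involution theta ->
  J1 ^t theta = - J1 -> J2 ^t theta = - J2 ->
  psdmx theta R1 -> psdmx theta R2 ->
  right_singular_chain (J1 + R1) (- (J2 + R2)) x ->
  forall i l, (tnth x l) ^t theta *m (J1 + R1) *m tnth x i = 0.
Proof.
move=> htheta hJ1 hJ2 hR1 hR2 hx i; have [x0 xS _] := hx.
have [m im] : exists m, m = i :> nat by exists i.
elim: m i im => [|m IHm] i im l; case: (unliftP ord0 i) => [j|] ij;
  rewrite ij in im *; try by rewrite -mulmxA x0 mulmx0.
- by [].
- have {}im : m = widen_ord (leqnSn k) j by case: im.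
  have [_ _ colB] := chain_form_step htheta hJ1 hJ2 hR1 hR2 hx (IHm _ im).
  by rewrite -mulmxA xS mulNmx mulmxN mulmxA colB oppr0.
Qed.

Lemma right_chain_kernel (F : numFieldType) (theta : {rmorphism F -> F}) n
    (J1 J2 R1 R2 : 'M[F]_n) k (x : k.+1.-tuple 'cV[F]_n) :
  positive_involution theta ->
  J1 ^t theta = - J1 -> J2 ^t theta = - J2 ->
  psdmx theta R1 -> psdmx theta R2 ->
  right_singular_chain (J1 + R1) (- (J2 + R2)) x ->
  (forall i, R1 *m tnth x i = 0 /\ R2 *m tnth x i = 0) /\
  right_singular_chain J1 (- J2) x.
Proof.
move=> htheta hJ1 hJ2 hR1 hR2 hx.
have Rx i : R1 *m tnth x i = 0 /\ R2 *m tnth x i = 0.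
  have coli := chain_form_eq0 htheta hJ1 hJ2 hR1 hR2 hx i.
  by have [] := chain_form_step htheta hJ1 hJ2 hR1 hR2 hx coli.
split=> //; have [x0 xS xmax] := hx.
have Ex i : (J1 + R1) *m tnth x i = J1 *m tnth x i.
  by rewrite mulmxDl (Rx i).1 addr0.
have Ax i : - (J2 + R2) *m tnth x i = - J2 *m tnth x i.
  by rewrite !mulNmx mulmxDl (Rx i).2 addr0.
by split=> [|j|]; rewrite -?Ex -?Ax.
Qed.

Lemma left_chain_adjoint (F : numFieldType) (theta : {rmorphism F -> F}) n
    (E A : 'M[F]_n) k (x : k.+1.-tuple 'cV[F]_n) :
  involutive theta ->
  left_singular_chain theta E A x <->
  right_singular_chain (E ^t theta) (A ^t theta) x.
Proof.
move=> thetaK.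
have adjE (N : 'M[F]_n) v : N ^t theta *m v = (v ^t theta *m N) ^t theta.
  by rewrite adjointM adjointK.
have adj_inj (a b : 'rV[F]_n) : a ^t theta = b ^t theta -> a = b.
  by move=> ab; rewrite -[a](adjointK _ thetaK) ab adjointK.
split=> [[x0 xS xmax]|[]].
  by split=> [|j|]; rewrite !adjE ?x0 ?xS ?xmax ?adjoint0.
rewrite !adjE => x0 xS xmax; split=> [|j|]; apply: adj_inj;
  by rewrite ?adjoint0 // -!adjE.
Qed.

Lemma singular_chain_kernel (F : numFieldType) (theta : {rmorphism F -> F}) n
    (J1 J2 R1 R2 : 'M[F]_n) k (x : k.+1.-tuple 'cV[F]_n) :
  positive_involution theta ->
  J1 ^t theta = - J1 -> J2 ^t theta = - J2 ->
  psdmx theta R1 -> psdmx theta R2 ->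
  (right_singular_chain (J1 + R1) (- (J2 + R2)) x ->
     (forall i : 'I_k.+1, R1 *m tnth x i = 0 /\ R2 *m tnth x i = 0) /\
     right_singular_chain J1 (- J2) x)
  /\
  (left_singular_chain theta (J1 + R1) (- (J2 + R2)) x ->
     (forall i : 'I_k.+1, R1 *m tnth x i = 0 /\ R2 *m tnth x i = 0) /\
     left_singular_chain theta J1 (- J2) x).
Proof.
move=> htheta hJ1 hJ2 hR1 hR2; split.
  exact: right_chain_kernel htheta _ _ _ _.
have [[thetaK _] [[hR1t _] [hR2t _]]] := (htheta, (hR1, hR2)).
(* The adjoint pencil has coefficients - J1 + R1 and - J2 + R2, to which the
   result on right chains applies. *)
move=> /(left_chain_adjoint _ _ _ thetaK).
rewrite adjointN !adjointD hJ1 hJ2 hR1t hR2t => hx.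
have hN (J : 'M[F]_n) : J ^t theta = - J -> (- J) ^t theta = - - J.
  by move=> hJ; rewrite adjointN hJ.
have [Rx hJx] := right_chain_kernel htheta (hN _ hJ1) (hN _ hJ2) hR1 hR2 hx.
split=> //; apply/(left_chain_adjoint _ _ _ thetaK).
by rewrite adjointN hJ1 hJ2.
Qed.

Theorem theorem4p4 (R : realType) (F : numFieldType) (theta : F -> F)
    (hF : real_or_complex R F theta)
    (n : nat) (J1 J2 R1 R2 : 'M[F]_n)
    (hJ1 : J1 ^t theta = - J1) (hJ2 : J2 ^t theta = - J2)
    (hR1 : psdmx theta R1) (hR2 : psdmx theta R2)
    (k : nat) (x : k.+1.-tuple 'cV[F]_n) :
  (right_singular_chain (J1 + R1) (- (J2 + R2)) x ->
     (forall i : 'I_k.+1, R1 *m tnth x i = 0 /\ R2 *m tnth x i = 0) /\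
     right_singular_chain J1 (- J2) x)
  /\
  (left_singular_chain theta (J1 + R1) (- (J2 + R2)) x ->
     (forall i : 'I_k.+1, R1 *m tnth x i = 0 /\ R2 *m tnth x i = 0) /\
     left_singular_chain theta J1 (- J2) x).
Proof.
case: F theta / hF J1 J2 R1 R2 hJ1 hJ2 hR1 hR2 x
  => [|] J1 J2 R1 R2 hJ1 hJ2 hR1 hR2 x.
- apply: (@singular_chain_kernel R idfun) => //.
  by split=> // z; rewrite -expr2 sqr_ge0.
- apply: (@singular_chain_kernel R[i] Num.conj) => //.
  by split=> [|z]; [exact: conjCK | rewrite mulrC mul_conjC_ge0].
Qed.
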